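(* Let $X$ be a Banach space, let $c:X\to\mathbb{R}$ be a differentiable function, and let $d:X\to\mathbb{R}$ be a convex function. Denote $h:=c-d$ and assume that $\mathrm{co}\, h$ makes sense. Then the following statements hold. (i) If $c\in\mathcal{C}^{1,u}(X)$ (resp. $c\in\mathcal{C}^{1,\alpha}(X)$, for some $0<\alpha\le1$), then $\mathrm{co}\, h\in\mathcal{C}^{1,u}(X)$ (resp. $\mathrm{co}\, h\in\mathcal{C}^{1,\alpha}(X)$). (ii) If $c\in\mathcal{C}_{\mathcal{B}}^{1,u}(X)$ (resp. $c\in\mathcal{C}_{\mathcal{B}}^{1,\alpha}(X)$, for some $0<\alpha\le1$) and $h$ is uniformly continuous on bounded sets and strongly coercive, i.e. $\lim_{\|x\|\to\infty}\frac{h(x)}{\|x\|}=+\infty$, then $\mathrm{co}\, h\in\mathcal{C}_{\mathcal{B}}^{1,u}(X)$ (resp. $\mathrm{co}\, h\in\mathcal{C}_{\mathcal{B}}^{1,\alpha}(X)$).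
   Context: The convex envelope $\mathrm{co}\, f$ of a function $f:X\to\mathbb{R}\cup\{+\infty\}$ is the greatest proper convex lower semi-continuous function below $f$; it makes sense if there exists a convex minorant of $f$. Its value at $x\in X$ is given by $$(\mathrm{co}\, f)(x)=\inf_{n\in\mathbb{N}}\Big\{\sum_{i=1}^n\lambda_i f(x_i): x=\sum_{i=1}^n\lambda_i x_i,\ \sum_{i=1}^n\lambda_i=1,\ (x_i,\lambda_i)_{i=1}^n\subset X\times\mathbb{R}_+\Big\}.$$ Differentiability is in the Fréchet sense. $\mathcal{C}^{1,u}(X)$ (resp. $\mathcal{C}_{\mathcal{B}}^{1,u}(X)$) is the set of differentiable functions on $X$ with uniformly continuous (resp. uniformly continuous on bounded sets) derivative. For $0<\alpha\le1$, $\mathcal{C}^{1,\alpha}(X)$ (resp. $\mathcal{C}_{\mathcal{B}}^{1,\alpha}(X)$) is the set of differentiable functions on $X$ with $\alpha$-Hölder continuous (resp. $\alpha$-Hölder continuous on bounded sets) derivative.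
   Formalization: ''co h makes sense'' is taken to mean that h has a proper convex lower semicontinuous minorant, not merely a convex one; otherwise c = 0 and d a discontinuous linear functional would be a counterexample. *)

(* Defs.v *)
From HB Require Import structures.
From mathcomp Require Export all_boot all_order all_algebra.
From mathcomp Require Export all_classical all_reals all_analysis.
Export Order.TTheory GRing.Theory Num.Theory.
Export numFieldNormedType.Exports.

Set Implicit Arguments.
Unset Strict Implicit.
Unset Printing Implicit Defensive.

Global Open Scope classical_set_scope.
Global Open Scope ring_scope.

Definition ereal_proper (R : realType) (X : Type) (f : X -> \bar R) : Prop :=
  (forall x, f x != -oo%E) /\ exists x, f x != +oo%E.

(* Intended for functions that avoid -oo, where the sum on the right-hand side
   is never of the form (-oo) + (+oo). *)
Definition ereal_convex (R : realType) (X : lmodType R) (f : X -> \bar R) :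
  Prop :=
  forall (x y : X) (t : R), 0 <= t <= 1 ->
    (f (t *: x + (1 - t) *: y)%R <= t%:E * f x + (1 - t)%:E * f y)%E.

Definition closed_convex_minorant (R : realType) (X : normedModType R)
    (f : X -> \bar R) : set (X -> \bar R) :=
  [set g | [/\ ereal_proper g, ereal_convex g, lower_semicontinuous g
             & forall x, (g x <= f x)%E]].

(* A merely convex minorant does not suffice: in infinite dimension, a
   discontinuous linear functional has no lower semicontinuous convex minorant
   at all. *)
Definition convex_envelope_makes_sense (R : realType) (X : normedModType R)
    (f : X -> \bar R) : Prop :=
  closed_convex_minorant f !=set0.

(* The greatest closed convex minorant (see convex_envelope_ge and
   convex_envelope_greatest). Where f is real-valued and continuous, this is the
   infimum of sum_i l_i f(x_i) over the finite convex combinations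
   x = sum_i l_i x_i; without continuity that infimum need not be lower
   semicontinuous. *)
Definition convex_envelope (R : realType) (X : normedModType R)
    (f : X -> \bar R) : X -> \bar R :=
  fun x => ereal_sup [set g x | g in closed_convex_minorant f].

Lemma convex_envelope_ge (R : realType) (X : normedModType R)
    (f g : X -> \bar R) :
  closed_convex_minorant f g -> forall x, (g x <= convex_envelope f x)%E.
Proof. by move=> fg x; apply: ereal_sup_ubound; exists g. Qed.

Lemma convex_envelope_greatest (R : realType) (X : normedModType R)
    (f : X -> \bar R) :
  ereal_proper f -> convex_envelope_makes_sense f ->
  closed_convex_minorant f (convex_envelope f).
Proof.
move=> [_ [x0 fx0]] [g0 mg0].
have le_f x : (convex_envelope f x <= f x)%E.
  by apply: ge_ereal_sup => _ [g [_ _ _ gf] <-]; exact: gf.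
split => //.
- split; first move=> x.
    have [[g0Ny _] _ _ _] := mg0.
    rewrite -ltNye; apply: lt_le_trans (convex_envelope_ge mg0 x).
    by rewrite ltNye.
  by exists x0; rewrite -ltey; apply: le_lt_trans (le_f x0) _; rewrite ltey.
- move=> x y t t01; apply: ge_ereal_sup => _ [g mg <-].
  have [_ gcvx _ _] := mg; apply: le_trans (gcvx x y t t01) _.
  case/andP: t01 => t0 t1.
  by apply: leeD; apply: lee_wpmul2l;
    rewrite ?lee_fin ?subr_ge0 //; exact: convex_envelope_ge.
- move=> x a /ereal_sup_gt[_ [g mg <-] agx].
  have [_ _ glsc _] := mg; have [V xV aV] := glsc _ _ agx.
  by exists V => // y Vy; apply: lt_le_trans (aV y Vy) (convex_envelope_ge mg y).
Qed.

Section classes.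
Variables (R : realType) (X : normedModType R).
Implicit Types (f : X -> R) (A : set X) (rho : X -> X -> R).

(* A genuine supremum only for bounded l, as is the case of a difference of two
   Frechet derivatives. *)
Definition dual_norm (l : X -> R) : R :=
  sup [set `|l v| | v in [set v : X | `|v| <= 1]].

Definition derivative_gap f (x y : X) : R :=
  dual_norm (fun v => 'd (f : X -> R^o) x v - 'd (f : X -> R^o) y v).

Definition value_gap f (x y : X) : R := `|f x - f y|.

(* rho x y stands for the distance between the images of x and y. *)
Definition unif_continuous_gap A rho : Prop :=
  forall e : R, 0 < e -> exists2 delta : R, 0 < delta &
    forall x y, A x -> A y -> `|x - y| < delta -> rho x y < e.

Definition hoelder_gap (a : R) A rho : Prop :=
  exists K : R, forall x y, A x -> A y -> rho x y <= K * `|x - y| `^ a.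

Definition Fdifferentiable f : Prop :=
  forall x, differentiable (f : X -> R^o) x.

Definition C1u : set (X -> R) :=
  [set f | Fdifferentiable f /\
    unif_continuous_gap [set: X] (derivative_gap f)].

Definition C1hoelder (a : R) : set (X -> R) :=
  [set f | Fdifferentiable f /\
    hoelder_gap a [set: X] (derivative_gap f)].

Definition C1uB : set (X -> R) :=
  [set f | Fdifferentiable f /\ forall B : set X, bounded_set B ->
    unif_continuous_gap B (derivative_gap f)].

Definition C1hoelderB (a : R) : set (X -> R) :=
  [set f | Fdifferentiable f /\ forall B : set X, bounded_set B ->
    hoelder_gap a B (derivative_gap f)].

Definition unif_continuous_on_bounded f : Prop :=
  forall B : set X, bounded_set B -> unif_continuous_gap B (value_gap f).

Definition strongly_coercive f : Prop :=
  forall M : R, exists r : R, forall x : X, r < `|x| -> M < f x / `|x|.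

Definition real_valued_in (K : set (X -> R)) (F : X -> \bar R) : Prop :=
  exists2 g : X -> R, K g & F = EFin \o g.

End classes.

(* Main.v *)
From HB Require Import structures.
From mathcomp Require Import lra ring.
Require Import Defs.

(* Write f for co h. For a fixed v and a bound m for the second differences
   h(x + v) + h(x - v) - 2 h(x), the function k(x) = (f(x + v) + f(x - v) - m) / 2
   is convex and lies below h, hence below f: second differences of f inherit the
   bounds of those of h, which are at most those of c because d is convex, and
   the latter are controlled by c' through the mean value theorem. If the bound
   m holds only on a large ball, k is replaced by its supporting cone at the
   point of interest, k(x) + k'(x; . - x), which strong coercivity keeps below h
   outside the ball. Finally, for a convex function a bound o(|v|) on the second
   differences makes the directional derivative linear, and bounds the variation
   of the derivative between x and y by the second differences at scale |x - y|. *)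

Set Implicit Arguments.
Unset Strict Implicit.
Unset Printing Implicit Defensive.

(** * Slopes and continuity of real-valued convex functions *)

Section convex_real.
Variables (R : realType) (X : normedModType R).
Implicit Types (f h k : X -> R) (x y u v w : X) (t s e M : R).

Definition convex_on_space f : Prop := forall x y t, 0 <= t <= 1 ->
  f (t *: x + (1 - t) *: y) <= t * f x + (1 - t) * f y.

Definition locally_bounded_above f : Prop :=
  forall x, exists M, \forall y \near x, f y <= M.

Lemma convex_midpoint f x v : convex_on_space f ->
  f x + f x <= f (x + v) + f (x - v).
Proof.
move=> cf; have := cf (x + v) (x - v) 2^-1; rewrite invr_ge0 invf_le1//.
rewrite ler0n ler1n => /(_ isT).
have h2 : 1 - 2^-1 = 2^-1 :> R by field.
have -> : 2^-1 *: (x + v) + (1 - 2^-1) *: (x - v) = x.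
  by rewrite h2 -scalerDr addrACA subrr addr0 scalerDr -scalerDl -div1r -splitr scale1r.
lra.
Qed.

(* x is the convex combination of x + s v and x - v with weights 1/(1+s), s/(1+s). *)
Lemma convex_slope_ge f x v s : convex_on_space f -> 0 < s ->
  f x - f (x - v) <= s^-1 * (f (x + s *: v) - f x).
Proof.
move=> cf s0; have s1 : 0 < 1 + s by rewrite addr_gt0.
have := cf (x + s *: v) (x - v) (1 + s)^-1.
have -> : 1 - (1 + s)^-1 = s * (1 + s)^-1 by field; rewrite gt_eqF.
have -> : (1 + s)^-1 *: (x + s *: v) + (s / (1 + s)) *: (x - v) = x.
  rewrite scalerDr scalerBr scalerA [_ / _]mulrC addrACA subrr addr0 -scalerDl.
  by rewrite -[X in X + _]mulr1 -mulrDr mulVf ?scale1r ?gt_eqF.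
rewrite invr_ge0 (ltW s1) invf_le1// lerDl ltW// => /(_ isT).
rewrite -(ler_pM2l s1) mulrDr !mulrA mulfV ?gt_eqF// mul1r.
rewrite [(1 + s) * s]mulrC -[s * (1 + s) / (1 + s)]mulrA mulfV ?gt_eqF// mulr1.
move=> H; rewrite ler_pdivlMl//; lra.
Qed.

Lemma convex_slope_le f x v s : convex_on_space f -> 0 < s <= 1 ->
  s^-1 * (f (x + s *: v) - f x) <= f (x + v) - f x.
Proof.
move=> cf /andP[s0 s1]; have := cf (x + v) x s; rewrite (ltW s0) s1 => /(_ isT).
rewrite scalerDr addrAC -scalerDl addrCA subrr addr0 scale1r => H.
rewrite ler_pdivrMl//; lra.
Qed.

Lemma convex_slope_mono f x v s t : convex_on_space f -> 0 < s -> s <= t ->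
  s^-1 * (f (x + s *: v) - f x) <= t^-1 * (f (x + t *: v) - f x).
Proof.
move=> cf s0 st; have t0 : 0 < t by apply: lt_le_trans st.
have := @convex_slope_le f x (t *: v) (s / t) cf.
rewrite divr_gt0//= ler_pdivrMr// mul1r st => /(_ isT).
rewrite scalerA divfK ?gt_eqF// => H.
by rewrite ler_pdivlMl//; apply: le_trans H; rewrite invf_div mulrA.
Qed.

(** Comparing slopes with a step of length [r / 2] bounds [f (x + v) - f x] above linearly in [|v|];
    the midpoint inequality turns the bound at [- v] into a lower bound at [v]. *)
Lemma convex_continuous f : convex_on_space f -> locally_bounded_above f ->
  continuous (f : X -> R^o).
Proof.
move=> cf bf x; have [M /nbhs_ballP[r /= r0 rM]] := bf x.
pose C := `|M - f x| + 1; have C0 : 0 < C by rewrite ltr_wpDl.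
have r2 : 0 < r / 2 by rewrite divr_gt0.
have up v : `|v| <= r / 2 -> f (x + v) - f x <= `|v| / (r / 2) * C.
  move=> vr; have [->|v0] := eqVneq v 0; first by rewrite addr0 subrr normr0 !mul0r.
  have nv0 : 0 < `|v| by rewrite normr_gt0.
  have := @convex_slope_le f x ((r / 2 / `|v|) *: v) (`|v| / (r / 2)) cf.
  rewrite divr_gt0//= ler_pdivrMr// mul1r vr => /(_ isT).
  rewrite scalerA mulrA divfK ?gt_eqF// mulfV ?gt_eqF// scale1r.
  rewrite ler_pdivrMl ?divr_gt0// => /le_trans; apply.
  rewrite ler_pM2l ?divr_gt0// /C.
  suff : f (x + (r / 2 / `|v|) *: v) <= M by have := ler_norm (M - f x); lra.
  apply: rM; rewrite -ball_normE /= opprD addrA subrr sub0r normrN normrZ.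
  rewrite ger0_norm ?divr_ge0 ?ltW// divfK ?gt_eqF//; lra.
apply/cvgrPdist_lt => e e0; near=> y.
have yx : `|y - x| <= r / 2.
  near: y; apply/nbhs_normP; exists (r / 2) => //= y; rewrite /ball_ /= distrC.
  exact: ltW.
have ye : `|y - x| / (r / 2) * C < e.
  rewrite -mulrA -ltr_pdivlMr ?mulr_gt0 ?invr_gt0//; near: y.
  apply/nbhs_normP; exists (e / ((r / 2)^-1 * C)) => /=.
    by rewrite divr_gt0// mulr_gt0 ?invr_gt0.
  by move=> y; rewrite /ball_ /= distrC.
have := up _ yx; have := up (- (y - x)); rewrite normrN => /(_ yx).
have := convex_midpoint x (y - x) cf; rewrite [x + (y - x)]addrC subrK.
move=> H1 H2 H3; rewrite ltr_norml; apply/andP; split; lra.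
Unshelve. all: by end_near. Qed.

End convex_real.

(** * The envelope as a real-valued greatest convex minorant *)

Section envelope.
Variables (R : realType) (X : normedModType R).
Implicit Types (c d f h k : X -> R) (g : X -> \bar R).

Lemma ereal_convexE f : ereal_convex (EFin \o f) <-> convex_on_space f.
Proof.
by split=> cf x y t t01; have := cf x y t t01;
  rewrite /= -!EFinM -EFinD lee_fin.
Qed.

Lemma convex_function_on_space f :
  convex_function [set: convex_lmodType X] f -> convex_on_space f.
Proof.
move=> cf x y t /andP[t0 t1].
have := cf (Itv01 t0 t1) x y; rewrite !inE => /(_ Logic.I Logic.I).
by [].
Qed.

Lemma locally_bounded_aboveW f h : (forall x, f x <= h x) ->
  locally_bounded_above h -> locally_bounded_above f.
Proof.
move=> fh bh x; have [M hM] := bh x; exists M.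
by apply: filterS hM => y; apply: le_trans.
Qed.

(** Lower semicontinuity is automatic: [k] inherits the local upper bounds of [h] and is therefore
    continuous. *)
Lemma convex_minorant_closed h k : locally_bounded_above h ->
  convex_on_space k -> (forall x, k x <= h x) ->
  closed_convex_minorant (EFin \o h) (EFin \o k).
Proof.
move=> bh ck kh; split=> //.
- by split=> //; exists 0.
- move=> x a; rewrite lte_fin => akx.
  have kc := convex_continuous ck (locally_bounded_aboveW kh bh).
  exists [set y | a < k y]; last by [].
  exact: (kc x _ (lt_nbhsr akx)).
Qed.

Lemma minorant_real h g : closed_convex_minorant (EFin \o h) g ->
  g = EFin \o (fine \o g).
Proof.
move=> [[gNy _] _ _ gh]; apply/funext => x /=; rewrite fineK// fin_numE gNy/=.
by rewrite -ltey (le_lt_trans (gh x))// ltry.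
Qed.

(* In infinite dimension a convex d need not be continuous; here the lower
   semicontinuous minorant g of c - d bounds d above by c - g. *)
Lemma subtrahend_locally_bounded c d : continuous (c : X -> R^o) ->
  convex_envelope_makes_sense (EFin \o (fun x => c x - d x)) ->
  locally_bounded_above d.
Proof.
move=> cc [g mg] x; have gE := minorant_real mg.
have [_ _ lg gh] := mg; move: lg gh; rewrite gE; set k := fine \o g => lk kh.
have kx1 : ((k x - 1)%:E < (EFin \o k) x)%E by rewrite lte_fin ltrBlDr ltrDl.
have [V xV kV] := lk _ _ kx1.
exists (c x + 1 - (k x - 1)); near=> y.
have cy : c y < c x + 1.
  by near: y; apply: (cc x _ (lt_nbhsl _)); rewrite ltrDl.
have Vy : V y by near: y.
have := kh y; rewrite lee_fin; have := kV y Vy; rewrite lte_fin.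
lra.
Unshelve. all: by end_near. Qed.

(** [d] enters with a minus sign: its local upper bounds give continuity by convexity, hence the
    local lower bounds used here. *)
Lemma difference_locally_bounded c d : continuous (c : X -> R^o) ->
  convex_on_space d -> locally_bounded_above d ->
  locally_bounded_above (fun x => c x - d x).
Proof.
move=> cc cd bd x.
exists (c x + 1 - (d x - 1)); near=> y.
have cy : c y < c x + 1.
  by near: y; apply: (cc x _ (lt_nbhsl _)); rewrite ltrDl.
have dy : d x - 1 < d y.
  near: y; have dx : d x - 1 < d x by rewrite ltrBlDr ltrDl.
  exact: (convex_continuous cd bd (lt_nbhsr dx)).
lra.
Unshelve. all: by end_near. Qed.

(** The competitors [k] are arbitrary convex functions, so testing maximality against a constructed
    [k] only requires convexity and [k <= h]. *)
Definition greatest_convex_minorant h f : Prop :=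
  [/\ convex_on_space f, forall x, f x <= h x &
      forall k, convex_on_space k -> (forall x, k x <= h x) ->
      forall x, k x <= f x].

Lemma convex_envelope_real h : locally_bounded_above h ->
  convex_envelope_makes_sense (EFin \o h) ->
  exists2 f, convex_envelope (EFin \o h) = EFin \o f &
    greatest_convex_minorant h f.
Proof.
move=> bh sh.
have ph : ereal_proper (EFin \o h) by split=> //; exists 0.
have mF := convex_envelope_greatest ph sh.
have FE := minorant_real mF; set f := fine \o _ in FE.
have fE x : (f x)%:E = convex_envelope (EFin \o h) x by rewrite FE.
exists f => //; split.
- by move: mF; rewrite FE => -[_ /ereal_convexE].
- by move=> x; rewrite -lee_fin fE; have [] := mF.
- move=> k ck kh x; rewrite -lee_fin fE.
  exact: (@convex_envelope_ge _ _ _ (EFin \o k) (convex_minorant_closed bh ck kh)).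
Qed.

End envelope.

(** * One-sided directional derivatives of convex functions *)

Section directional_derivative.
Variables (R : realType) (X : normedModType R).
Variables (f : X -> R) (x : X).
Hypothesis cf : convex_on_space f.
Implicit Types (u v w : X) (s t e m : R).

(** Slopes of a convex function increase with [s], so this infimum is the limit as [s] tends to 0
    from the right. *)
Definition directional_derivative v : R :=
  inf [set s^-1 * (f (x + s *: v) - f x) | s in [set s : R | 0 < s]].

Local Notation p := directional_derivative.

Lemma directional_derivative_le v s : 0 < s ->
  p v <= s^-1 * (f (x + s *: v) - f x).
Proof.
move=> s0; apply: ge_inf; last by exists s.
(* The backward slope bounds every forward slope from below, so the infimum is a genuine one. *)
by exists (f x - f (x - v)) => _ [t t0 <-]; exact: convex_slope_ge.
Qed.

Lemma directional_derivative_le1 v : p v <= f (x + v) - f x.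
Proof.
by have := @directional_derivative_le v 1 ltr01; rewrite invr1 mul1r scale1r.
Qed.

Lemma directional_derivative_ge v m :
  (forall s, 0 < s -> m <= s^-1 * (f (x + s *: v) - f x)) -> m <= p v.
Proof.
move=> H; apply: lb_le_inf; first by exists (1^-1 * (f (x + 1 *: v) - f x)), 1 => /=.
by move=> _ [s s0 <-]; exact: H.
Qed.

(** By monotonicity of slopes the bound persists for all smaller steps, so that two directions can
    share one step. *)
Lemma directional_derivative_approx v e : 0 < e ->
  exists2 s, 0 < s & forall t, 0 < t <= s ->
    t^-1 * (f (x + t *: v) - f x) < p v + e.
Proof.
move=> e0.
have hp : has_inf [set s^-1 * (f (x + s *: v) - f x) | s in [set s : R | 0 < s]].
  split; first by exists (1^-1 * (f (x + 1 *: v) - f x)), 1 => /=.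
  by exists (f x - f (x - v)) => _ [t t0 <-]; exact: convex_slope_ge.
have [_ [s s0 <-] sp] := inf_adherent e0 hp.
exists s => // t /andP[t0 ts]; apply: le_lt_trans sp.
exact: convex_slope_mono.
Qed.

(** The point [x + (s / 2) *: (u + w)] is the midpoint of [x + s *: u] and [x + s *: w]. *)
Lemma directional_derivativeD u w : p (u + w) <= p u + p w.
Proof.
apply/ler_addgt0Pr => e e0; have e2 : 0 < e / 2 by rewrite divr_gt0.
have [s1 s10 H1] := directional_derivative_approx u e2.
have [s2 s20 H2] := directional_derivative_approx w e2.
pose s := Num.min s1 s2; have s0 : 0 < s by rewrite lt_min s10.
have {}H1 : s^-1 * (f (x + s *: u) - f x) < p u + e / 2.
  by apply: H1; rewrite s0 ge_min lexx.
have {}H2 : s^-1 * (f (x + s *: w) - f x) < p w + e / 2.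
  by apply: H2; rewrite s0 ge_min lexx orbT.
have h0 : 0 < s / 2 by rewrite divr_gt0.
have := directional_derivative_le (u + w) h0.
have hE z : (s / 2) *: (z + z) = s *: z by rewrite scalerDr -scalerDl -splitr.
have Eu : x + (s / 2) *: (u + w) + (s / 2) *: (u - w) = x + s *: u.
  by rewrite -addrA -scalerDr addrACA subrr addr0 hE.
have Ew : x + (s / 2) *: (u + w) - (s / 2) *: (u - w) = x + s *: w.
  by rewrite -addrA -scalerBr opprB [u + w]addrC addrACA subrr addr0 hE.
have := convex_midpoint (x + (s / 2) *: (u + w)) ((s / 2) *: (u - w)) cf.
rewrite Eu Ew.
set a := f (x + _ *: (_ + _)); set b := f (x + s *: u) in H1 *.
set c := f (x + s *: w) in H2 *.
move=> Hm; rewrite invf_div => Hp; apply: (le_trans Hp).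
have : 2 / s * (a - f x) <= s^-1 * (b - f x) + s^-1 * (c - f x).
  rewrite -mulrDr [2 / s]mulrC -mulrA ler_pM2l ?invr_gt0//; lra.
lra.
Qed.

Lemma directional_derivativeZ v t : 0 < t -> p (t *: v) = t * p v.
Proof.
(* This inequality for all positive factors, applied to [t^-1], also gives its converse. *)
have Hle w s : 0 < s -> p (s *: w) <= s * p w.
  move=> s0; rewrite -ler_pdivrMl//; apply: directional_derivative_ge => r r0.
  have rs : 0 < r / s by rewrite divr_gt0.
  have := directional_derivative_le (s *: w) rs.
  by rewrite scalerA divfK ?gt_eqF// ler_pdivrMl// mulrA invf_div.
move=> t0; apply/eqP; rewrite eq_le Hle//= -ler_pdivlMl//.
have it : 0 < t^-1 by rewrite invr_gt0.
by have := Hle (t *: v) _ it; rewrite scalerA mulVf ?gt_eqF// scale1r.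
Qed.

Lemma directional_derivative0 : p 0 = 0.
Proof.
apply/eqP; rewrite eq_le; have := directional_derivative_le1 0.
rewrite addr0 subrr => -> /=.
apply: directional_derivative_ge => s s0.
by rewrite scaler0 addr0 subrr mulr0.
Qed.

Lemma directional_derivative_convex : convex_on_space p.
Proof.
move=> u w t /andP[]; rewrite le_eqVlt => /predU1P[<- _|t0].
  by rewrite scale0r add0r subr0 scale1r mul0r add0r mul1r.
rewrite le_eqVlt => /predU1P[->|t1].
  by rewrite subrr !scale0r addr0 scale1r mul0r addr0 mul1r.
apply: le_trans (directional_derivativeD _ _) _.
by rewrite !directional_derivativeZ// subr_gt0.
Qed.

End directional_derivative.

(** * Second differences of the greatest convex minorant *)

Section second_difference.
Variables (R : realType) (X : normedModType R).
Implicit Types (c d f h k : X -> R) (x u v w : X) (r s t e m : R) (A : set X).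

(** One constant [e * s] serves all increments in the ball of radius [s]; it is the [m] subtracted
    from the symmetric mean. *)
Definition second_difference_le f A s e : Prop :=
  forall x v, A x -> `|v| <= s -> f (x + v) + f (x - v) - (f x + f x) <= e * s.

Lemma convex_symmetric_mean f v m : convex_on_space f ->
  convex_on_space (fun x => (f (x + v) + f (x - v) - m) / 2).
Proof.
move=> cf x y t t01.
have sh w : t *: x + (1 - t) *: y + w = t *: (x + w) + (1 - t) *: (y + w).
  by rewrite !scalerDr addrACA -scalerDl addrCA subrr addr0 scale1r.
have := cf (x + v) (y + v) t t01; have := cf (x - v) (y - v) t t01.
rewrite -!sh; lra.
Qed.

Lemma minorant_second_difference h f s e : greatest_convex_minorant h f ->
  second_difference_le h setT s e -> second_difference_le f setT s e.
Proof.
move=> [cf fh mf] Hh x v _ vs.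
have := mf _ (convex_symmetric_mean v (e * s) cf) _ x.
suff kh y : (f (y + v) + f (y - v) - e * s) / 2 <= h y.
  by move=> /(_ kh); lra.
by have := Hh y v Logic.I vs; have := fh (y + v); have := fh (y - v); lra.
Qed.

Lemma convex_translate f w m : convex_on_space f ->
  convex_on_space (fun x => m + f (x - w)).
Proof.
move=> cf x y t t01; have := cf (x - w) (y - w) t t01.
have -> : t *: (x - w) + (1 - t) *: (y - w) = t *: x + (1 - t) *: y - w.
  by rewrite !scalerDr addrACA -scalerDl addrCA subrr addr0 scale1r.
lra.
Qed.

Definition bounded_above_on_bounded h : Prop :=
  forall r, exists M, forall x, `|x| <= r -> h x <= M.

(* The supporting cone at x of the averaged function k has a slope bounded in
   terms of r only, so that coercivity puts it below h outside a ball; there k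
   itself need not be a minorant of h. *)
Lemma coercive_minorant_second_difference h f r :
  greatest_convex_minorant h f -> bounded_above_on_bounded h ->
  strongly_coercive h -> 0 <= r ->
  exists2 rho, r <= rho & forall s e, s <= 2 * r ->
    second_difference_le h [set x | `|x| <= rho] s e ->
    second_difference_le f [set x | `|x| <= r] s e.
Proof.
move=> gf bh ch r0; have [cf fh mf] := gf.
(* The radius covers [x + z + v] with [|x| <= r], [|v| <= 2 * r] and [z] a unit vector. *)
have [M hM] := bh (3 * r + 1).
have fM x : `|x| <= 3 * r + 1 -> f x <= M by move=> /hM; apply: le_trans.
(* Reflection through 0 turns the upper bound into a lower one. *)
have fm x : `|x| <= 3 * r + 1 -> 2 * f 0 - M <= f x.
  move=> xr; have := convex_midpoint 0 x cf; rewrite !add0r.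
  by have := fM (- x); rewrite normrN => /(_ xr); lra.
(* [L] bounds the oscillation of [f] on that ball. *)
pose L := M - (2 * f 0 - M).
have L0 : 0 <= L.
  have : `|0 : X| <= 3 * r + 1 by rewrite normr0; lra.
  by move=> H; have := fM 0 H; have := fm 0 H; rewrite /L; lra.
(* For [|y| >= 1] this slope times [|y|] dominates [M + L * (|y| + r)], which bounds the cone at
   [y]. *)
have [rho0 hrho] := ch (`|M| + L * r + L).
pose rho := Num.max r (Num.max 1 rho0).
exists rho; first by rewrite le_max lexx.
move=> s e sr Hh x v /= xr vs.
have vr : `|v| <= 2 * r by apply: le_trans sr.
(* The increment 0 yields the sign of [e * s], on which [k x <= M] relies. *)
have es0 : 0 <= e * s.
  have := Hh x 0; rewrite /= normr0 addr0 subr0 subrr; apply.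
    by rewrite le_max xr.
  exact: le_trans vs.
pose k y := (f (y + v) + f (y - v) - e * s) / 2.
have ck : convex_on_space k by exact: convex_symmetric_mean.
pose p := directional_derivative k x.
have xv3 w : `|w| <= 2 * r + 1 -> `|x + w| <= 3 * r + 1.
  by move=> wr; rewrite (le_trans (ler_normD _ _))//; lra.
(* A unit step in the direction of [u] raises [k] by at most [L], and the directional derivative is
   below that slope. *)
have pL u : p u <= L * `|u|.
  have [->|u0] := eqVneq u 0.
    by rewrite /p directional_derivative0// normr0 mulr0.
  have nu : 0 < `|u| by rewrite normr_gt0.
  have := directional_derivative_le x ck u (s := `|u|^-1).
  rewrite invr_gt0 invrK mulrC => /(_ nu) /le_trans; apply.
  rewrite ler_pM2r// /k; set z := `|u|^-1 *: u.
  have z1 : `|z| = 1 by rewrite normrZ normfV normr_id mulVf ?gt_eqF.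
  have Hz1 : `|x + z + v| <= 3 * r + 1.
    by rewrite -addrA xv3// (le_trans (ler_normD _ _))// z1; lra.
  have Hz2 : `|x + z - v| <= 3 * r + 1.
    by rewrite -addrA xv3// (le_trans (ler_normB _ _))// z1; lra.
  have Hx1 : `|x + v| <= 3 * r + 1 by rewrite xv3//; lra.
  have Hx2 : `|x - v| <= 3 * r + 1 by rewrite xv3// normrN; lra.
  have := fM _ Hz1; have := fM _ Hz2; have := fm _ Hx1; have := fm _ Hx2.
  rewrite /L; lra.
have kx : k x <= M.
  have Hx1 : `|x + v| <= 3 * r + 1 by rewrite xv3//; lra.
  have Hx2 : `|x - v| <= 3 * r + 1 by rewrite xv3// normrN; lra.
  have := fM _ Hx1; have := fM _ Hx2; rewrite /k; lra.
(* Maximality of [f] is tested against the cone, whose value at [x] is [k x]. *)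
have := mf _ (convex_translate x (k x) (directional_derivative_convex x ck)) _ x.
rewrite subrr directional_derivative0// addr0.
suff Ah y : k x + p (y - x) <= h y by move=> /(_ Ah); rewrite /k; lra.
(* Inside the ball the cone lies below [k], and [k] lies below [h] by the assumption on second
   differences. *)
have [yrho|yrho] := leP `|y| rho.
  have := directional_derivative_le1 x ck (y - x); rewrite [x + (y - x)]addrC subrK => pk.
  have ky : k y <= h y.
    have := Hh y v yrho vs; have := fh (y + v); have := fh (y - v).
    by rewrite /k; lra.
  by rewrite -/p in pk; lra.
move: yrho; rewrite /rho !gt_max => /and3P[_ y1 yrho0].
have ny : 0 < `|y| by apply: lt_trans y1.
have := hrho _ yrho0; rewrite ltr_pdivlMr// => hy.
have H1 : L * `|y - x| <= L * (`|y| + r).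
  by rewrite ler_wpM2l// (le_trans (ler_normB _ _))// lerD2l.
have H2 : `|M| <= `|M| * `|y| by rewrite ler_peMr// ltW.
have H3 : L * r <= L * r * `|y| by rewrite ler_peMr ?mulr_ge0// ltW.
have := pL (y - x); have := ler_norm M; lra.
Qed.

End second_difference.

(** * Differences of Frechet derivatives and the mean value theorem *)

Section derivative_gap.
Variables (R : realType) (X : normedModType R).
Implicit Types (c f : X -> R) (x y v : X) (e : R).

(* The linearity lemmas of the library yield the operations of R^o, which lra and
   the rewriting lemmas on R do not recognize. *)
Lemma diffRD f x u v : 'd (f : X -> R^o) x (u + v) =
  'd (f : X -> R^o) x u + 'd (f : X -> R^o) x v :> R.
Proof. exact: linearD. Qed.

Lemma diffRZ f x (a : R) v :
  'd (f : X -> R^o) x (a *: v) = a * 'd (f : X -> R^o) x v :> R.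
Proof. exact: linearZ. Qed.

Lemma diffR0 f x : 'd (f : X -> R^o) x 0 = 0 :> R.
Proof. exact: linear0. Qed.

Lemma diffRN f x v : 'd (f : X -> R^o) x (- v) = - 'd (f : X -> R^o) x v :> R.
Proof. exact: linearN. Qed.

Lemma derivative_gap_le f x y e :
  (forall v, `|v| <= 1 ->
     `|'d (f : X -> R^o) x v - 'd (f : X -> R^o) y v| <= e) ->
  derivative_gap f x y <= e.
Proof.
move=> H; apply: ge_sup; last by move=> _ [v v1 <-]; exact: H.
by exists (`|'d (f : X -> R^o) x 0 - 'd (f : X -> R^o) y 0|), 0 => //=;
  rewrite normr0.
Qed.

(** Both derivatives are bounded linear maps, so the supremum behind [derivative_gap] is a true
    upper bound; [v] is then normalized. *)
Lemma derivative_gap_ge f x y v : Fdifferentiable f ->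
  `|'d (f : X -> R^o) x v - 'd (f : X -> R^o) y v| <=
    derivative_gap f x y * `|v|.
Proof.
move=> df.
have bnd z : exists2 M, 0 < M & forall v, `|'d (f : X -> R^o) z v| <= M * `|v|.
  have /linear_bounded_continuous/linear_boundedP : continuous ('d (f : X -> R^o) z).
    exact: diff_continuous.
  by move=> /pinfty_ex_gt0[M M0 HM]; exists M.
have [Mx Mx0 HMx] := bnd x; have [My My0 HMy] := bnd y.
have [->|v0] := eqVneq v 0; first by rewrite !diffR0 subrr !normr0 mulr0.
have nv : 0 < `|v| by rewrite normr_gt0.
rewrite -ler_pdivrMr//; apply: ub_le_sup.
  exists (Mx + My) => _ [w /= w1 <-]; rewrite (le_trans (ler_normB _ _))//.
  apply: lerD; [apply: le_trans (HMx w) _|apply: le_trans (HMy w) _];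
    by rewrite ger_pMr.
exists (`|v|^-1 *: v).
  by rewrite /= normrZ normfV normr_id mulVf// gt_eqF.
by rewrite !diffRZ -mulrBr normrM normfV normr_id mulrC.
Qed.

Lemma derivative_gapxx f x : derivative_gap f x x = 0.
Proof.
apply/eqP; rewrite eq_le derivative_gap_le/=; last first.
  by move=> v _; rewrite subrr normr0.
apply: ub_le_sup; first by exists 0 => _ [v _ <-]; rewrite subrr normr0.
by exists 0; rewrite /= ?normr0// subrr normr0.
Qed.

Lemma is_derive_line c x v (t : R) : Fdifferentiable c ->
  is_derive t 1 (fun t : R => c (x + t *: v) : R^o) ('d (c : X -> R^o) (x + t *: v) v).
Proof.
move=> dc; pose l : R -> X := cst x + *:%R ^~ v.
have dl : is_diff (t : R) l (0 + *:%R ^~ v).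
  exact: is_diffD.
have dcl : is_diff (l t) (c : X -> R^o) ('d (c : X -> R^o) (l t)).
  exact/differentiableP/dc.
have dcomp := @is_diff_comp _ _ _ _ _ _ _ _ _ dl dcl.
apply: (@DeriveDef _ _ _ _ _ ((c : X -> R^o) \o l)).
  exact/derivable1_diffP.
rewrite deriveE// diff_val -[LHS]/('d (c : X -> R^o) (l t) (0 + 1 *: v)).
by rewrite add0r scale1r.
Qed.

(** The mean value theorem is applied on [0, 1] to [c (x + t *: v) + c (x - t *: v)]; its derivative
    is the difference of the derivatives of [c] at two symmetric points, applied to [v]. *)
Lemma second_difference_derivative_gap c x v e : Fdifferentiable c ->
  (forall t, 0 <= t <= 1 ->
     derivative_gap c (x + t *: v) (x - t *: v) <= e) ->
  c (x + v) + c (x - v) - (c x + c x) <= e * `|v|.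
Proof.
move=> dc He.
pose psi : R -> R := (fun t : R => c (x + t *: v)) + (fun t => c (x + t *: - v)).
pose dpsi t := 'd (c : X -> R^o) (x + t *: v) v +
               'd (c : X -> R^o) (x + t *: - v) (- v).
have dp (t : R) : is_derive t 1 psi (dpsi t).
  by apply: is_deriveD; exact: is_derive_line.
have cpsi : {within `[0, 1], continuous psi}.
  apply: continuous_subspaceT => t.
  by apply: differentiable_continuous; apply/derivable1_diffP.
have [t] := MVT_segment ler01 (fun t _ => dp t) cpsi.
rewrite in_itv/= => t01; rewrite subr0 mulr1 /psi /dpsi.
rewrite -[LHS]/((c (x + 1 *: v) + c (x + 1 *: - v)) -
                (c (x + 0 *: v) + c (x + 0 *: - v))).
rewrite !scale0r !scale1r !addr0 => ->; rewrite diffRN scalerN.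
apply: le_trans (ler_norm _) _.
apply: le_trans (derivative_gap_ge _ _ _ dc) _.
by rewrite ler_wpM2r// He.
Qed.

End derivative_gap.

(** * Differentiability of convex functions with small second differences *)

Section convex_differentiable.
Variables (R : realType) (X : normedModType R).
Implicit Types (f : X -> R) (x y v w : X) (s t e : R) (A : set X).

(** Small second differences make the sublinear [directional_derivative] odd, hence linear; local
    upper bounds make it continuous; the remainder at [v] lies between 0 and the second
    difference. *)
Lemma convex_differentiable f x :
  convex_on_space f -> locally_bounded_above f ->
  (forall e, 0 < e -> exists2 s0, 0 < s0 &
     forall s, 0 <= s <= s0 -> second_difference_le f [set x] s e) ->
  differentiable (f : X -> R^o) x /\
  'd (f : X -> R^o) x = directional_derivative f x :> (X -> R).
Proof.
move=> cf bf Hs; pose p := directional_derivative f x.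
have pN v : p (- v) = - p v.
  apply/eqP; rewrite -addr_eq0 eq_le; apply/andP; split; last first.
    by rewrite -(directional_derivative0 x cf) -[X in _ _ _ X <= _](addNr v)
      directional_derivativeD.
  apply/ler_addgt0Pr => e e0; rewrite add0r.
  (* These scalings give [|s *: v| <= s0] and make the bound [e / (1 + |v|) * s0] equal to [s * e],
     also for [v = 0]. *)
  have v1 : 0 < 1 + `|v| by rewrite ltr_pwDl.
  have [s0 s00 Hs0] := Hs (e / (1 + `|v|)) (divr_gt0 e0 v1).
  pose s := s0 / (1 + `|v|).
  have s_gt0 : 0 < s by rewrite divr_gt0.
  have sE : s * (1 + `|v|) = s0 by rewrite divfK ?gt_eqF.
  have sv : `|s *: v| <= s0.
    rewrite normrZ gtr0_norm// -sE ler_pM2l//; lra.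
  have := directional_derivative_le x cf v s_gt0.
  have := directional_derivative_le x cf (- v) s_gt0.
  rewrite scalerN -/p => Hn Hp.
  have := Hs0 s0 _ x (s *: v) erefl sv; rewrite lexx ltW// => /(_ isT) H.
  have {}H : s^-1 * (f (x - s *: v) - f x) + s^-1 * (f (x + s *: v) - f x) <= e.
    rewrite -mulrDr ler_pdivrMl//.
    have : e / (1 + `|v|) * s0 = s * e by rewrite /s; field; rewrite gt_eqF.
    lra.
  lra.
have pZ t v : p (t *: v) = t * p v.
  have [t0|t0|<-] := ltgtP 0 t; last first.
  - by rewrite scale0r mul0r; exact: directional_derivative0.
  - have t1 : 0 < - t by rewrite oppr_gt0.
    have := directional_derivativeZ x cf v t1.
    by rewrite -/p scaleNr pN mulNr => /oppr_inj.
  - exact: directional_derivativeZ.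
have pD u w : p (u + w) = p u + p w.
  apply/eqP; rewrite eq_le directional_derivativeD//=.
  have := directional_derivativeD x cf (u + w) (- w).
  by rewrite addrK -/p pN; lra.
have plin : linear (p : X -> R^o) by move=> t u w; rewrite pD pZ.
pose plinM := GRing.isLinear.Build _ _ _ _ (p : X -> R^o) plin.
pose P : {linear X -> R^o} := HB.pack (p : X -> R^o) plinM.
have cP : continuous P.
  apply/linear_bounded_continuous.
  have [M /nbhs_normP[r /= r0 rM]] := bf x.
  apply/ex_bound; exists (M - f x); apply/nbhs_normP; exists r => //= v.
  rewrite /ball_ /= sub0r normrN => vr.
  have pv w : `|w| < r -> p w <= M - f x.
    move=> wr; apply: le_trans (directional_derivative_le1 _ cf _) _.
    by rewrite lerB// rM//= opprD addrA subrr sub0r normrN.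
  rewrite ler_norml -[X in X && _]lerNl -pN !pv ?normrN//.
have expd : (f : X -> R^o) \o shift x = cst (f x : R^o) + P +o_ 0 id.
  apply/eqaddoP => e e0; have [s0 s00 Hs0] := Hs e e0.
  apply/nbhs_normP; exists s0 => //= v; rewrite /ball_ /= sub0r normrN => vs.
  have := Hs0 `|v| _ x v erefl (lexx _); rewrite normr_ge0 ltW// => /(_ isT).
  have := directional_derivative_le1 x cf v.
  have := directional_derivative_le1 x cf (- v).
  rewrite -/p pN => H1 H2 H3.
  rewrite -[X in `|X|]/(f (v + x) - (f x + p v)) [v + x]addrC.
  rewrite ler_norml; apply/andP; split; lra.
have dE := diff_unique cP expd.
split=> //; apply/diff_locallyP; rewrite dE; split=> //.
Qed.

(** Tangent inequalities at [x] towards [y + s *: v] and [x - (y - x)], and at [y] towards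
    [y - s *: v], add up to two second differences, at [y] with increment [s *: v] and at [x] with
    increment [y - x]; hence the factor 2. *)
Lemma convex_derivative_gap f A x y e :
  convex_on_space f -> Fdifferentiable f ->
  (forall z, 'd (f : X -> R^o) z = directional_derivative f z :> (X -> R)) ->
  A x -> A y -> x != y -> second_difference_le f A `|x - y| e ->
  derivative_gap f x y <= 2 * e.
Proof.
move=> cf df dE Ax Ay xy Hs; pose s := `|x - y|.
have s0 : 0 < s by rewrite normr_gt0 subr_eq0.
have tangent z w : 'd (f : X -> R^o) z w <= f (z + w) - f z.
  by rewrite dE; exact: directional_derivative_le1.
have H v : `|v| <= 1 -> 'd (f : X -> R^o) x v - 'd (f : X -> R^o) y v <= 2 * e.
  move=> v1.
  have sv : `|s *: v| <= s by rewrite normrZ gtr0_norm// ger_pMr.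
  have H1 := Hs y (s *: v) Ay sv.
  have yx : `|y - x| <= `|x - y| by rewrite distrC.
  have H2 := Hs x (y - x) Ax yx; rewrite [x + (y - x)]addrC subrK in H2.
  have H3 := tangent y (- (s *: v)); rewrite diffRN diffRZ in H3.
  have H4 := tangent x (- (y - x)); rewrite diffRN in H4.
  have H5 := tangent x (y - x + s *: v).
  rewrite diffRD diffRZ addrA [x + (y - x)]addrC subrK in H5.
  rewrite -(ler_pM2l s0).
  rewrite -/s in H1 H2.
  lra.
apply: derivative_gap_le => v v1; rewrite ler_norml; apply/andP; split.
  by have := H (- v); rewrite normrN !diffRN => /(_ v1); lra.
exact: H.
Qed.

End convex_differentiable.

(** * Bounded sets and upper bounds on them *)

Section bounded.
Variables (R : realType) (X : normedModType R).
Implicit Types (h : X -> R) (r : R) (B : set X).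

Lemma closed_ball0_bounded r : bounded_set [set x : X | `|x| <= r].
Proof.
exists r; split=> [|M rM x xr]; first exact: num_real.
exact: le_trans xr (ltW rM).
Qed.

Lemma bounded_set_ball B : bounded_set B ->
  exists2 r, 0 < r & B `<=` [set x | `|x| <= r].
Proof. by move=> /pinfty_ex_gt0[r r0 Br]; exists r. Qed.

(** The segment from 0 to [x] is cut into [n] pieces shorter than [delta], along each of which [h]
    rises by less than 1. *)
Lemma unif_continuous_bounded_above h :
  unif_continuous_on_bounded h -> bounded_above_on_bounded h.
Proof.
move=> uh r; have [delta d0 hd] := uh _ (closed_ball0_bounded r) 1 ltr01.
(* For negative [r] the ball is empty. *)
have [r0|r0] := leP 0 r; last first.
  by exists 0 => x xr; have := lt_le_trans r0 (normr_ge0 x); rewrite ltNge xr.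
pose n := (Num.truncn (r / delta)).+1.
have rn : r / n%:R < delta.
  rewrite ltr_pdivrMr ?ltr0n// mulrC -ltr_pdivrMr//.
  by rewrite /n truncnS_gt.
exists (h 0 + n%:R) => x xr.
have step i : (i <= n)%N -> h ((i%:R / n%:R) *: x) <= h 0 + i%:R.
  elim: i => [_|i IH ilt]; first by rewrite mul0r scale0r addr0.
  have inball j : (j <= n)%N -> `|(j%:R / n%:R) *: x| <= r.
    move=> jn; rewrite normrZ ger0_norm ?divr_ge0//.
    rewrite (le_trans _ xr)// ler_piMl//.
    by rewrite ler_pdivrMr ?ltr0n// mul1r ler_nat.
  have := hd _ _ (inball _ ilt) (inball _ (ltnW ilt)).
  rewrite -scalerBl -mulrBl -natrB// subSnn mul1r normrZ ger0_norm ?invr_ge0//.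
  have nx : n%:R^-1 * `|x| < delta.
    by rewrite mulrC (le_lt_trans _ rn)// ler_wpM2r// invr_ge0.
  move=> /(_ nx); rewrite /value_gap => H.
  have := IH (ltnW ilt); have := ler_norm (h ((i.+1%:R / n%:R) *: x) -
    h ((i%:R / n%:R) *: x)).
  have i1 : i.+1%:R = i%:R + 1 :> R by rewrite natr1.
  by move: (h _) H => a H; lra.
by have := step n (leqnn n); rewrite divff ?scale1r// pnatr_eq0.
Qed.

End bounded.

(** * Transfer of the modulus of continuity from the derivative of [c] to that of the envelope *)

Section transfer.
Variables (R : realType) (X : normedModType R).
Variables (c d f : X -> R).
Hypotheses (dc : Fdifferentiable c) (cd : convex_on_space d).
Hypothesis bh : locally_bounded_above (fun x => c x - d x).
Hypothesis gf : greatest_convex_minorant (fun x => c x - d x) f.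
Implicit Types (A : set X) (S : set R) (x y z v : X) (r s t e : R).

Local Notation h := (fun x => c x - d x).

(** Convexity of [d] gives its second difference the favourable sign; the points [z + t *: v] and
    [z - t *: v] lie in [A'] within distance [2 * s]. *)
Lemma difference_second_difference (A' : set X) A s e :
  (forall z v, A z -> `|v| <= s -> A' (z + v)) -> 0 <= s ->
  (forall x y, A' x -> A' y -> `|x - y| <= 2 * s -> derivative_gap c x y <= e) ->
  second_difference_le h A s e.
Proof.
move=> AA' s0 He z v Az vs.
have Hc t : 0 <= t <= 1 -> derivative_gap c (z + t *: v) (z - t *: v) <= e.
  move=> /andP[t0 t1]; have tv : `|t *: v| <= s.
    by rewrite normrZ ger0_norm// (le_trans _ vs)// ler_piMl.
  apply: He; [exact: AA'|by apply: AA'; rewrite ?normrN|].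
  rewrite opprB addrC addrA addrNK (le_trans (ler_normD _ _))//.
  by rewrite mulrDl mul1r lerD.
(* At [t = 0] the gap vanishes, whence the sign needed for [e * |v| <= e * s]. *)
have e0 : 0 <= e.
  have := Hc 0; rewrite lexx ler01 scale0r subr0 addr0 derivative_gapxx.
  exact.
have := second_difference_derivative_gap dc Hc; have := convex_midpoint z v cd.
have : e * `|v| <= e * s by rewrite ler_wpM2l.
lra.
Qed.

(** Common interface of the two cases: all three sets are [setT] globally, whereas locally [A] is a
    ball, [A'] a larger one, and [S] limits the scale. *)
Definition gap_controls (A' : set X) A S : Prop := forall s e, 0 <= s -> S s ->
  (forall x y, A' x -> A' y -> `|x - y| <= 2 * s -> derivative_gap c x y <= e) ->
  second_difference_le f A s e.

Lemma gap_controls_setT : gap_controls setT setT setT.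
Proof.
move=> s e s0 _ He; apply: (minorant_second_difference gf).
exact: difference_second_difference He.
Qed.

Lemma gap_controls_ball r : bounded_above_on_bounded h ->
  strongly_coercive h -> 0 <= r ->
  exists2 r', r <= r' & gap_controls [set x | `|x| <= r'] [set x | `|x| <= r]
    [set s | s <= 2 * r].
Proof.
move=> bah ch r0.
have [rho rrho Hrho] := coercive_minorant_second_difference gf bah ch r0.
(* The margin [2 * r] absorbs the increments, as [s <= 2 * r]. *)
exists (rho + 2 * r); first lra.
move=> s e s0 /= sr He; apply: Hrho => //; apply: difference_second_difference He => //.
by move=> z v /= zr vs; rewrite (le_trans (ler_normD _ _))// lerD// (le_trans vs).
Qed.

Lemma gap_controls_differentiable (A' : set X) A S r x :
  gap_controls A' A S -> unif_continuous_gap A' (derivative_gap c) ->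
  0 < r -> [set s | s <= r] `<=` S -> A x ->
  differentiable (f : X -> R^o) x /\
  'd (f : X -> R^o) x = directional_derivative f x :> (X -> R).
Proof.
move=> gc uc r0 rS Ax; have [cf fh _] := gf.
apply: convex_differentiable => //; first exact: locally_bounded_aboveW bh.
move=> e e0; have [delta d0 Hd] := uc e e0.
(* [r] keeps [s] in [S], and [delta / 3] makes [2 * s] strictly less than [delta]. *)
exists (Num.min r (delta / 3)); first by rewrite lt_min r0 divr_gt0.
move=> s /andP[s0]; rewrite le_min => /andP[sr sd] z v -> vs.
apply: (gc s e) => //; first exact: rS.
by move=> a b A'a A'b ab; apply/ltW/Hd => //; lra.
Qed.

Lemma gap_controls_gap (A' : set X) A S x y e : Fdifferentiable f ->
  (forall z, 'd (f : X -> R^o) z = directional_derivative f z :> (X -> R)) ->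
  gap_controls A' A S -> A x -> A y -> S `|x - y| -> A' x ->
  (forall a b, A' a -> A' b -> `|a - b| <= 2 * `|x - y| ->
    derivative_gap c a b <= e) ->
  derivative_gap f x y <= 2 * e.
Proof.
move=> df dE gc Ax Ay Sxy A'x He; have [cf _ _] := gf.
(* For [x = y] the scale is 0 and cannot be divided by; the claim reduces to the sign of [e], given
   by [He] at [x]. *)
have [<-|xy] := eqVneq x y.
  have := He x x A'x A'x; rewrite !derivative_gapxx subrr normr0 mulr_ge0//.
  by move=> /(_ isT) e0; rewrite mulr_ge0.
by apply: (convex_derivative_gap cf df dE Ax Ay xy); exact: gc.
Qed.

Section on_a_set.
Variables (A' A : set X) (S : set R).
Hypotheses (df : Fdifferentiable f)
  (dE : forall z, 'd (f : X -> R^o) z = directional_derivative f z :> (X -> R))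
  (gc : gap_controls A' A S) (AA' : A `<=` A')
  (AS : forall x y, A x -> A y -> S `|x - y|).

Lemma gap_controls_unif_continuous :
  unif_continuous_gap A' (derivative_gap c) ->
  unif_continuous_gap A (derivative_gap f).
Proof.
(* [e / 3] keeps the inequality strict after the factor 2; [delta / 2] pays for the doubled distance
   in the gap of [c]. *)
move=> uc e e0; have e3 : 0 < e / 3 by rewrite divr_gt0.
have [delta d0 Hd] := uc _ e3; exists (delta / 2); first by rewrite divr_gt0.
move=> x y Ax Ay xy.
have := @gap_controls_gap A' A S x y (e / 3) df dE gc Ax Ay (AS Ax Ay) (AA' Ax).
suff H a b : A' a -> A' b -> `|a - b| <= 2 * `|x - y| ->
    derivative_gap c a b <= e / 3.
  by move=> /(_ H); lra.
by move=> A'a A'b ab; apply/ltW/Hd => //; lra.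
Qed.

Lemma gap_controls_hoelder (a : R) : 0 <= a ->
  hoelder_gap a A' (derivative_gap c) -> hoelder_gap a A (derivative_gap f).
Proof.
(* The first 2 comes from the two second differences, the power of 2 from the doubled distance; the
   absolute value allows a negative [K]. *)
move=> a0 [K HK]; exists (2 * (`|K| * 2 `^ a)) => x y Ax Ay.
rewrite -!mulrA -powRM//.
apply: (gap_controls_gap df dE gc) => //; [exact: AS|exact: AA'|].
move=> u v A'u A'v uv; apply: le_trans (HK _ _ A'u A'v) _.
apply: le_trans (_ : `|K| * `|u - v| `^ a <= _).
  by rewrite ler_wpM2r ?powR_ge0// ler_norm.
by rewrite ler_wpM2l// ge0_ler_powR ?nnegrE// mulr_ge0.
Qed.

End on_a_set.

End transfer.

(** * From Hoelder to uniform continuity, and the four statements *)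

Lemma hoelder_unif_continuous (R : realType) (X : normedModType R) (a : R)
    (A : set X) (rho : X -> X -> R) : 0 < a ->
  hoelder_gap a A rho -> unif_continuous_gap A rho.
Proof.
move=> a0 [K HK] e e0; pose C := `|K| + 1.
have C0 : 0 < C by rewrite ltr_wpDl.
(* This radius solves [C * delta ^ a = e]; the 1 in [C] avoids a division by 0. *)
exists ((e / C) `^ a^-1); first by rewrite powR_gt0 ?divr_gt0.
move=> x y Ax Ay xy; apply: le_lt_trans (HK _ _ Ax Ay) _.
have : `|x - y| `^ a < e / C.
  rewrite -[ltRHS]powRr1 ?divr_ge0 ?ltW// -(mulVf (lt0r_neq0 a0)).
  by rewrite powRrM gt0_ltr_powR ?nnegrE ?powR_ge0.
rewrite ltr_pdivlMr// mulrC; apply: le_lt_trans.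
by rewrite ler_wpM2r ?powR_ge0// /C (le_trans (ler_norm _))// lerDl.
Qed.

Theorem theorem7 (R : realType) (X : completeNormedModType R) (c d : X -> R)
    (c_diff : Fdifferentiable c)
    (d_convex : convex_function [set: convex_lmodType X] d) :
  let h : X -> R := fun x => c x - d x in
  let co_h : X -> \bar R := convex_envelope (EFin \o h) in
  convex_envelope_makes_sense (EFin \o h) ->
  ((C1u c -> real_valued_in (@C1u R X) co_h) /\
   (forall a : R, 0 < a <= 1 ->
      C1hoelder a c -> real_valued_in (C1hoelder a) co_h)) /\
  ((C1uB c -> unif_continuous_on_bounded h -> strongly_coercive h ->
      real_valued_in (@C1uB R X) co_h) /\
   (forall a : R, 0 < a <= 1 ->
      C1hoelderB a c -> unif_continuous_on_bounded h -> strongly_coercive h ->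
      real_valued_in (C1hoelderB a) co_h)).
Proof.
move=> h co_h sense.
have cc : continuous (c : X -> R^o).
  by move=> x; apply: differentiable_continuous.
have cd := convex_function_on_space d_convex.
have bh : locally_bounded_above h.
  exact: difference_locally_bounded (subtrahend_locally_bounded cc sense).
have [f co_hE gf] := convex_envelope_real bh sense.
have global_diff : unif_continuous_gap setT (derivative_gap c) -> forall x,
    differentiable (f : X -> R^o) x /\
    'd (f : X -> R^o) x = directional_derivative f x :> (X -> R).
  move=> uc x; have gc := gap_controls_setT c_diff cd gf.
  exact: (gap_controls_differentiable bh gf gc uc ltr01).
have local_control : unif_continuous_on_bounded h -> strongly_coercive h ->
    forall B : set X, bounded_set B -> exists r r', [/\ 0 < r,
      B `<=` [set x | `|x| <= r], r <= r' &
      gap_controls c f [set x | `|x| <= r'] [set x | `|x| <= r]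
        [set s | s <= 2 * r]].
  move=> uh ch B /bounded_set_ball[r r0 Br].
  have [r' rr' gc] := gap_controls_ball c_diff cd gf
    (unif_continuous_bounded_above uh) ch (ltW r0).
  by exists r, r'.
have local_diff : (forall B : set X, bounded_set B ->
      unif_continuous_gap B (derivative_gap c)) ->
    unif_continuous_on_bounded h -> strongly_coercive h -> forall x,
    differentiable (f : X -> R^o) x /\
    'd (f : X -> R^o) x = directional_derivative f x :> (X -> R).
  move=> uc uh ch x.
  (* Differentiability is pointwise, so a ball around 0 that reaches [x] suffices. *)
  have [r [r' [r0 Br _ gc]]] :=
    local_control uh ch _ (@closed_ball0_bounded _ X `|x|).
  have uc' := uc _ (@closed_ball0_bounded _ X r').
  apply: (gap_controls_differentiable bh gf gc uc' r0) => [s /= sr|]; first lra.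
  by apply: Br => /=.
(* Distances inside the ball of radius [r] stay in the range of scales [s <= 2 * r]. *)
have dist_le (r : R) (x y : X) : `|x| <= r -> `|y| <= r -> `|x - y| <= 2 * r.
  by move=> xr yr; rewrite (le_trans (ler_normB _ _))// mulrDl mul1r lerD.
split; split.
- move=> [_ uc]; have fd := global_diff uc; exists f; last exact: co_hE.
  have df x := (fd x).1; have dE x := (fd x).2; split; first exact: df.
  have gc := gap_controls_setT c_diff cd gf.
  exact: (gap_controls_unif_continuous gf df dE gc (fun _ H => H)
    (fun _ _ _ _ => Logic.I) uc).
- move=> a /andP[a0 _] [_ hc].
  have fd := global_diff (hoelder_unif_continuous a0 hc); exists f; last exact: co_hE.
  have df x := (fd x).1; have dE x := (fd x).2; split; first exact: df.
  have gc := gap_controls_setT c_diff cd gf.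
  exact: (gap_controls_hoelder gf df dE gc (fun _ H => H)
    (fun _ _ _ _ => Logic.I) (ltW a0) hc).
- move=> [_ uc] uh ch; have fd := local_diff uc uh ch; exists f; last exact: co_hE.
  have df x := (fd x).1; have dE x := (fd x).2; split; first exact: df.
  move=> B bB.
  have [r [r' [r0 Br rr' gc]]] := local_control uh ch B bB.
  have AA' : [set x : X | `|x| <= r] `<=` [set x | `|x| <= r'].
    by move=> x /= /le_trans; apply.
  have := gap_controls_unif_continuous gf df dE gc AA' (dist_le r)
    (uc _ (@closed_ball0_bounded _ X _)).
  move=> uf e /uf[delta d0 Hd]; exists delta => // x y /Br Bx /Br By.
  exact: Hd.
- move=> a /andP[a0 _] [_ hc] uh ch.
  have uc B bB := hoelder_unif_continuous a0 (hc B bB).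
  have fd := local_diff uc uh ch; exists f; last exact: co_hE.
  have df x := (fd x).1; have dE x := (fd x).2; split; first exact: df.
  move=> B bB.
  have [r [r' [r0 Br rr' gc]]] := local_control uh ch B bB.
  have AA' : [set x : X | `|x| <= r] `<=` [set x | `|x| <= r'].
    by move=> x /= /le_trans; apply.
  have [K HK] := gap_controls_hoelder gf df dE gc AA' (dist_le r) (ltW a0)
    (hc _ (@closed_ball0_bounded _ X _)).
  by exists K => x y /Br Bx /Br By; exact: HK.
Qed.
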